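(* Let $(M,H,G)$ be a (non-hyper-Kähler) quaternionic Kähler NH-manifold determined by a local 1-form $\omega_1$ through $$(\nabla_xJ_1)y=0,\qquad (\nabla_xJ_2)y=\omega_1(x)J_3y,\qquad (\nabla_xJ_3)y=-\omega_1(x)J_2y,$$ where $\omega_1(x)=-\theta_2(J_3x)=\theta_3(J_2x)$ and the quantities $\nabla J_2$, $\nabla J_3$ are non-zero. Then $(M,H,G)$ is an isotropic hyper-Kähler NH-manifold if and only if the vector $\Omega_1$ corresponding to $\omega_1$ with respect to $g$ is an isotropic vector regarding $g$.
   Context: $M$ is a differentiable manifold of dimension $4n$. An almost hypercomplex structure on $M$ is a triple $H=(J_1,J_2,J_3)$ of almost complex structures with $J_\alpha=J_\beta\circ J_\gamma=-J_\gamma\circ J_\beta$ and $J_\alpha^2=-I$ for all cyclic permutations $(\alpha,\beta,\gamma)$ of $(1,2,3)$. Put $\varepsilon_1=1$, $\varepsilon_2=\varepsilon_3=-1$. An NH-metric structure $G=(g,g_1,g_2,g_3)$ on $(M,H)$ consists of a pseudo-Riemannian metric $g$ of neutral signature $(2n,2n)$ with $g(x,y)=\varepsilon_\alpha g(J_\alpha x,J_\alpha y)$ for $\alpha=1,2,3$, together with $g_\alpha(x,y)=g(J_\alpha x,y)=-\varepsilon_\alpha g(x,J_\alpha y)$. $(M,H,G)$ is then an almost hypercomplex NH-manifold. Let $\nabla$ be the Levi-Civita connection of $g$. $(M,H,G)$ is a quaternionic Kähler NH-manifold if there are local 1-forms $\omega_1,\omega_2,\omega_3$ with $(\nabla_xJ_\alpha)y=\omega_\gamma(x)J_\beta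 y-\omega_\beta(x)J_\gamma y$ for all cyclic permutations $(\alpha,\beta,\gamma)$ of $(1,2,3)$; it is hyper-Kähler if $\nabla J_\alpha=0$ for $\alpha=1,2,3$. Let $F_\alpha(x,y,z)=g((\nabla_xJ_\alpha)y,z)$ and $\theta_\alpha(z)=g^{ij}F_\alpha(e_i,e_j,z)$ for a basis $\{e_i\}$ of the tangent space. The vector $\Omega_1$ corresponding to $\omega_1$ is given by $\omega_1(x)=g(x,\Omega_1)$. A vector $x$ is isotropic regarding $g$ if $g(x,x)=0$ and $x\neq 0$. The square norm of $\nabla J_\alpha$ is $\|\nabla J_\alpha\|^2=g^{ij}g^{kl}g((\nabla_{e_i}J_\alpha)e_k,(\nabla_{e_j}J_\alpha)e_l)$. An almost hypercomplex NH-manifold is an isotropic hyper-Kähler NH-manifold if $\|\nabla J_\alpha\|^2=0$ for $\alpha=1,2,3$. *)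

(* Defs.v *)
From mathcomp Require Import all_boot all_order all_algebra.
From mathcomp Require Import all_classical all_reals all_analysis.

Set Implicit Arguments.
Unset Strict Implicit.
Unset Printing Implicit Defensive.

Import Order.TTheory GRing.Theory Num.Theory.
Import numFieldNormedType.Exports.

Local Open Scope classical_set_scope.
Local Open Scope ring_scope.

(* C^k and C^oo maps on an open subset U of a normed space; in finite dimension
   "all directional derivatives are C^k" is the usual recursive clause. *)
Fixpoint Ck_on (R : realType) (V W : normedModType R) (k : nat) (U : set V)
    (f : V -> W) : Prop :=
  match k with
  | 0 => forall u, U u -> {for u, continuous f}
  | k'.+1 => (forall u, U u -> differentiable f u) /\
             (forall v, Ck_on k' U (fun u => 'D_v f u))
  end.

Definition smooth_on (R : realType) (V W : normedModType R) (U : set V)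
  (f : V -> W) : Prop := forall k, Ck_on k U f.

(* [cinv] is total but only meaningful on the open set [cmap @` source]. *)
Record chart (R : realType) (d : nat) (M : topologicalType) := Chart {
  source : set M;
  cmap :> M -> 'rV[R]_d;
  cinv : 'rV[R]_d -> M;
  source_open : open source;
  target_open : open (cmap @` source);
  cmapK : forall p, source p -> cinv (cmap p) = p;
  cmap_continuous : forall p, source p -> {for p, continuous cmap};
  cinv_continuous : forall u, (cmap @` source) u -> {for u, continuous cinv} }.

(* Every point p comes with a preferred chart [chart_at p] of the atlas.  It only
   serves to identify T_pM with R^d, so that the tangent vectors at p are the
   v : 'rV[R]_d, read as components in [chart_at p]. *)
Record manifold (R : realType) (d : nat) := Manifold {
  carrier :> topologicalType;
  atlas : set (chart R d carrier);
  chart_at : carrier -> chart R d carrier;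
  chart_at_atlas : forall p, atlas (chart_at p);
  source_chart_at : forall p, source (chart_at p) p;
  atlas_compatible : forall c c', atlas c -> atlas c' ->
    smooth_on (c @` (source c `&` source c')) (c' \o cinv c);
  carrier_hausdorff : hausdorff_space carrier;
  carrier_second_countable : @second_countable carrier }.

Section Manifold.
Context {R : realType} {d : nat} {M : manifold R d}.
Implicit Types (p : M) (U : set M) (c : chart R d M).

Local Notation T := 'rV[R]_d.

(* Components at p are rows: the components x in chart c become
   x *m jac c c' p in chart c'. *)
Definition jac c c' p : 'M[R]_d := 'J (c' \o cinv c) (c p).

Definition smooth_function_on U (f : M -> R) : Prop :=
  forall c, atlas c ->
    smooth_on (c @` (U `&` source c)) (f \o cinv c : T -> R^o).

Definition smooth_field_on U (X : M -> T) : Prop :=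
  forall c, atlas c ->
    smooth_on (c @` (U `&` source c))
      ((fun q => X q *m jac (chart_at q) c q) \o cinv c).

Definition smooth_function_at p (f : M -> R) : Prop :=
  exists U, [/\ open U, U p & smooth_function_on U f].

Definition smooth_field_at p (X : M -> T) : Prop :=
  exists U, [/\ open U, U p & smooth_field_on U X].

(* the derivative x(f) of f along the tangent vector x at p *)
Definition dfun (f : M -> R) p (x : T) : R :=
  'D_x (f \o cinv (chart_at p) : T -> R^o) (chart_at p p).

Definition one_form_on U (omega : M -> T -> R) : Prop :=
  (forall p, U p -> forall (a : R) (x y : T),
     omega p (a *: x + y) = a * omega p x + omega p y) /\
  (forall V X, open V -> V `<=` U -> smooth_field_on V X ->
     smooth_function_on V (fun p => omega p (X p))).

(* smooth (1,1)-tensor fields *)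
Record endo_field := EndoField {
  endo :> M -> T -> T;
  endo_linear : forall p (a : R) (x y : T),
    endo p (a *: x + y) = a *: endo p x + endo p y;
  endo_smooth : forall U X, open U -> smooth_field_on U X ->
    smooth_field_on U (fun p => endo p (X p)) }.

Record pseudo_metric := PseudoMetric {
  metric :> M -> T -> T -> R;
  metric_linear : forall p (a : R) (x y z : T),
    metric p (a *: x + y) z = a * metric p x z + metric p y z;
  metric_sym : forall p x y, metric p x y = metric p y x;
  metric_nondegenerate : forall p x, (forall y, metric p x y = 0) -> x = 0;
  metric_smooth : forall U X Y, open U ->
    smooth_field_on U X -> smooth_field_on U Y ->
    smooth_function_on U (fun p => metric p (X p) (Y p)) }.

(* signature (k, d - k): the rows of P are a pseudo-orthonormal basis of T_pM *)
Definition has_signature (g : pseudo_metric) (k : nat) : Prop :=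
  forall p, exists2 P : 'M[R]_d, P \in unitmx &
    forall i j, g p (row i P) (row j P) =
      if i == j then (if (i < k)%N then 1 else -1) else 0.

(* [nabla p x Y] is the covariant derivative at p of Y along x in T_pM.  The
   Leibniz rule for functions that are smooth only near p makes it local in Y. *)
Record connection := Connection {
  nabla :> forall p, T -> (M -> T) -> T;
  nabla_linear : forall p (a : R) (x y : T) Y, smooth_field_at p Y ->
    nabla p (a *: x + y) Y = a *: nabla p x Y + nabla p y Y;
  nabla_add : forall p x Y Z, smooth_field_at p Y -> smooth_field_at p Z ->
    nabla p x (fun q => Y q + Z q) = nabla p x Y + nabla p x Z;
  nabla_leibniz : forall p x f Y, smooth_function_at p f ->
    smooth_field_at p Y ->
    nabla p x (fun q => f q *: Y q) = dfun f p x *: Y p + f p *: nabla p x Y;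
  nabla_smooth : forall U X Y, open U ->
    smooth_field_on U X -> smooth_field_on U Y ->
    smooth_field_on U (fun p => nabla p (X p) Y) }.

(* nabla_X Y - nabla_Y X = [X, Y], as derivations acting on germs of functions *)
Definition torsion_free (D : connection) : Prop :=
  forall p X Y f, smooth_field_at p X -> smooth_field_at p Y ->
    smooth_function_at p f ->
    dfun f p (D p (X p) Y - D p (Y p) X) =
      dfun (fun q => dfun f q (Y q)) p (X p) -
      dfun (fun q => dfun f q (X q)) p (Y p).

Definition metric_compatible (g : pseudo_metric) (D : connection) : Prop :=
  forall p x Y Z, smooth_field_at p Y -> smooth_field_at p Z ->
    dfun (fun q => g q (Y q) (Z q)) p x =
      g p (D p x Y) (Z p) + g p (Y p) (D p x Z).

Definition levi_civita (g : pseudo_metric) (D : connection) : Prop :=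
  torsion_free D /\ metric_compatible g D.

(* The local extension of y in T_pM with constant components in [chart_at p]. *)
Definition extend p (y : T) : M -> T :=
  fun q => y *m jac (chart_at p) (chart_at q) q.

(* (nabla_x J) y = nabla_x (J Y) - J (nabla_x Y), where Y is a local extension
   of y; the value does not depend on the extension. *)
Definition cov_endo (D : connection) (J : endo_field) p (x y : T) : T :=
  D p x (fun q => J q (extend p y q)) - J p (D p x (extend p y)).

(* The coordinate basis at p; the contractions below, against the inverse Gram
   matrix g^{ij}, do not depend on the basis. *)
Definition e_ (i : 'I_d) : T := delta_mx 0 i.

Definition ginv (g : pseudo_metric) p : 'M[R]_d :=
  invmx (\matrix_(i, j) g p (e_ i) (e_ j)).

Definition isotropic (g : pseudo_metric) p (x : T) : Prop :=
  g p x x = 0 /\ x <> 0.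

(* The indices 1, 2, 3 are residues modulo 3 (so 3 = 0 in 'Z_3); the cyclic
   permutations of (1, 2, 3) are then the (a, a + 1, a + 2), a : 'Z_3. *)
Definition eps (a : 'Z_3) : R := if a == 1 then 1 else -1.

Record almost_hypercomplex := AlmostHypercomplex {
  J_ :> 'Z_3 -> endo_field;
  J_cyclic : forall a p x, J_ a p x = J_ (a + 1) p (J_ (a + 2) p x);
  J_anticyclic : forall a p x, J_ a p x = - J_ (a + 2) p (J_ (a + 1) p x);
  J_square : forall a p x, J_ a p (J_ a p x) = - x }.

End Manifold.

Arguments endo_field {R d} M.
Arguments pseudo_metric {R d} M.
Arguments connection {R d} M.
Arguments almost_hypercomplex {R d} M.

Section NHManifold.
Context {R : realType} {n : nat} {M : manifold R (4 * n)}.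
Implicit Types (p : M) (J : almost_hypercomplex M) (D : connection M).

Local Notation T := 'rV[R]_(4 * n).

Record nh_metric (J : almost_hypercomplex M) := NHMetric {
  nh_g :> pseudo_metric M;
  nh_g_ : 'Z_3 -> M -> T -> T -> R;
  nh_neutral : has_signature nh_g (2 * n);
  nh_compatible : forall a p x y,
    nh_g p x y = eps a * nh_g p (J a p x) (J a p y);
  nh_g_l : forall a p x y, nh_g_ a p x y = nh_g p (J a p x) y;
  nh_g_r : forall a p x y, nh_g_ a p x y = - eps a * nh_g p x (J a p y) }.

Definition F_ J (g : pseudo_metric M) D (a : 'Z_3) p (x y z : T) : R :=
  g p (cov_endo D (J a) p x y) z.

Definition theta_ J (g : pseudo_metric M) D (a : 'Z_3) p (z : T) : R :=
  \sum_i \sum_j ginv g p i j * F_ J g D a p (e_ i) (e_ j) z.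

Definition sqnorm_nabla J (g : pseudo_metric M) D (a : 'Z_3) p : R :=
  \sum_i \sum_j \sum_k \sum_l ginv g p i j * ginv g p k l *
    g p (cov_endo D (J a) p (e_ i) (e_ k)) (cov_endo D (J a) p (e_ j) (e_ l)).

Definition hyper_kahler J D : Prop :=
  forall a p x y, cov_endo D (J a) p x y = 0.

Definition quaternionic_kahler J D : Prop :=
  forall p, exists (U : set M) (omega : 'Z_3 -> M -> T -> R),
    [/\ open U, U p, forall a, one_form_on U (omega a) &
      forall a q x y, U q ->
        cov_endo D (J a) q x y =
          omega (a + 2) q x *: J (a + 1) q y - omega (a + 1) q x *: J (a + 2) q y].

Definition isotropic_hyper_kahler J (g : pseudo_metric M) D : Prop :=
  forall a p, sqnorm_nabla J g D a p = 0.

Definition nowhere_zero (S : M -> T -> T -> T) : Prop :=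
  forall p, exists x y, S p x y <> 0.

End NHManifold.

(* Main.v *)
Require Import Defs.
From mathcomp Require Import all_boot all_order all_algebra.
From mathcomp Require Import all_classical all_reals all_analysis.
From mathcomp Require Import ring.

Import Order.TTheory GRing.Theory Num.Theory.
Import numFieldNormedType.Exports.
Local Open Scope classical_set_scope.
Local Open Scope ring_scope.

(** Everything happens in one tangent space.  If [nabla J_a] at [p] is a pure tensor
    in the sense that [(nabla_x J_a) y = g(x, w) J_b y] for a fixed vector [w],
    then its square norm splits as a product of two contractions against [g^{ij}]:

      [||nabla J_a||^2 = (g^{ij} g(e_i, w) g(e_j, w)) (g^{kl} g(J_b e_k, J_b e_l))].

    The first factor is [g(w, w)] because [g^{ij}] is the metric on covectors; the
    second is [eps_b] times the trace [g^{kl} g_{kl} = 4n], because [J_b] preserves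
    [g] up to the sign [eps_b] ([sqnorm_nabla_pure]).  For [J_2] one takes
    [w = Omega_1], for [J_3] one takes [w = - Omega_1], so both square norms equal
    [- 4n g(Omega_1, Omega_1)], while that of [J_1] vanishes.  As [4n <> 0] in
    [R], the square norms vanish exactly when [g(Omega_1, Omega_1) = 0]; and
    [Omega_1] is never the zero vector because [nabla J_2] vanishes nowhere. *)

Section PseudoMetric.
Context {R : realType} {d : nat} {M : manifold R d}.
Variables (g : pseudo_metric M) (p : M).
Implicit Types x y z w : 'rV[R]_d.

Lemma metric0l z : g p 0 z = 0.
Proof.
have /eqP := metric_linear g p 1 0 0 z.
by rewrite scale1r addr0 mul1r -subr_eq subrr eq_sym => /eqP.
Qed.

Lemma metricDl x y z : g p (x + y) z = g p x z + g p y z.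
Proof. by have := metric_linear g p 1 x y z; rewrite scale1r mul1r. Qed.

Lemma metricZl a x z : g p (a *: x) z = a * g p x z.
Proof. by have := metric_linear g p a x 0 z; rewrite metric0l !addr0. Qed.

Lemma metricZr a x z : g p x (a *: z) = a * g p x z.
Proof. by rewrite Defs.metric_sym metricZl Defs.metric_sym. Qed.

Lemma metricNr x z : g p x (- z) = - g p x z.
Proof. by rewrite -scaleN1r metricZr mulN1r. Qed.

Lemma metricNN x z : g p (- x) (- z) = g p x z.
Proof. by rewrite metricNr Defs.metric_sym metricNr opprK Defs.metric_sym. Qed.

Definition gram : 'M[R]_d := \matrix_(i, j) g p (e_ i) (e_ j).

Lemma metric_sum_l x z : g p x z = \sum_i x 0 i * g p (e_ i) z.
Proof.
rewrite {1}(row_sum_delta x).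
rewrite (big_morph (fun y => g p y z) (id1 := 0) (op1 := +%R)).
- by apply: eq_bigr => i _; rewrite metricZl.
- by move=> ? ?; rewrite metricDl.
- exact: metric0l.
Qed.

Lemma metric_basis_gram i w : g p (e_ i) w = (gram *m w^T) i 0.
Proof.
rewrite Defs.metric_sym metric_sum_l mxE; apply: eq_bigr => j _.
by rewrite !mxE mulrC Defs.metric_sym.
Qed.

Lemma metric_gram x z : g p x z = (x *m (gram *m z^T)) 0 0.
Proof.
rewrite metric_sum_l [RHS]mxE; apply: eq_bigr => i _.
by rewrite metric_basis_gram.
Qed.

Lemma gram_unit : gram \in unitmx.
Proof.
rewrite -row_free_unit; apply/inj_row_free => v vG.
by apply: (@metric_nondegenerate _ _ _ g p) => y; rewrite metric_gram mulmxA vG mul0mx mxE.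
Qed.

(** [g^{ij}] is the metric carried over to covectors, here evaluated on the
    covector [g(-, w)]: in matrix form, [(w G) G^-1 (G w^T) = w G w^T]. *)
Lemma ginv_flat w :
  \sum_i \sum_j ginv g p i j * (g p (e_ i) w * g p (e_ j) w) = g p w w.
Proof.
have flat i : (w *m gram) 0 i = g p (e_ i) w.
  rewrite Defs.metric_sym metric_sum_l mxE; apply: eq_bigr => j _.
  by rewrite mxE.
rewrite [RHS]metric_gram -(mulKVmx gram_unit (gram *m w^T)) (mulmxA w).
rewrite [RHS]mxE; apply: eq_bigr => i _.
rewrite flat [X in _ = _ * X]mxE mulr_sumr; apply: eq_bigr => j _.
by rewrite -metric_basis_gram mulrCA.
Qed.

Lemma ginv_trace :
  \sum_k \sum_l ginv g p k l * g p (e_ k) (e_ l) = d%:R.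
Proof.
rewrite -(mxtrace1 R d) -(mulVmx gram_unit); apply: eq_bigr => k _.
by rewrite [RHS]mxE; apply: eq_bigr => l _; rewrite [gram l k]mxE Defs.metric_sym.
Qed.

End PseudoMetric.

Lemma eps_sqr (R : realType) (a : 'Z_3) : eps a * eps a = 1 :> R.
Proof. by rewrite /eps; case: ifP; rewrite ?mulrNN mulr1. Qed.

(** The square norm of a covariant derivative of the form
    [g(-, w)] tensored with [J_b] is the product of the square norms of its two
    factors; since [J_b] preserves [g] up to [eps_b], its own square norm is
    [eps_b] times the dimension. *)
Lemma sqnorm_nabla_pure (R : realType) (n : nat) (M : manifold R (4 * n))
    (J : almost_hypercomplex M) (g : nh_metric J) (D : connection M)
    (a b : 'Z_3) (p : M) (w : 'rV[R]_(4 * n)) :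
  (forall x y, cov_endo D (J a) p x y = g p x w *: J b p y) ->
  sqnorm_nabla J g D a p = eps b * (4 * n)%:R * g p w w.
Proof.
move=> covJ.
have gJJ x y : g p (J b p x) (J b p y) = eps b * g p x y.
  by rewrite (nh_compatible g b p x y) mulrA eps_sqr mul1r.
rewrite -(ginv_trace g p) -(ginv_flat g p w) [RHS]mulrC mulr_suml.
apply: eq_bigr => i _; rewrite mulr_suml; apply: eq_bigr => j _.
rewrite [RHS]mulrA mulr_sumr; apply: eq_bigr => k _.
rewrite mulr_sumr; apply: eq_bigr => l _.
rewrite !covJ metricZl metricZr gJJ; ring.
Qed.

(* The local 1-form omega_1 is given by 1-forms omega i on the members U i of an
   open cover of M, and Omega i is the vector field on U i corresponding to it. *)
Theorem corollary4p1 (R : realType) (n : nat) (M : manifold R (4 * n))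
    (J : almost_hypercomplex M) (g : nh_metric J) (D : connection M)
    (hD : levi_civita g D)
    (hnHK : ~ hyper_kahler J D)
    (hQK : quaternionic_kahler J D)
    (I : Type) (U : I -> set M)
    (Uopen : forall i, open (U i))
    (Ucover : forall p, exists i, U i p)
    (omega : I -> M -> 'rV[R]_(4 * n) -> R)
    (homega : forall i, one_form_on (U i) (omega i))
    (hJ1 : forall i p x y, U i p -> cov_endo D (J 1) p x y = 0)
    (hJ2 : forall i p x y, U i p ->
       cov_endo D (J 2) p x y = omega i p x *: J 3 p y)
    (hJ3 : forall i p x y, U i p ->
       cov_endo D (J 3) p x y = - omega i p x *: J 2 p y)
    (htheta2 : forall i p x, U i p ->
       omega i p x = - theta_ J g D 2 p (J 3 p x))
    (htheta3 : forall i p x, U i p ->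
       omega i p x = theta_ J g D 3 p (J 2 p x))
    (hJ2nz : nowhere_zero (cov_endo D (J 2)))
    (hJ3nz : nowhere_zero (cov_endo D (J 3)))
    (Omega : I -> M -> 'rV[R]_(4 * n))
    (hOmega : forall i p x, U i p -> omega i p x = g p x (Omega i p)) :
  isotropic_hyper_kahler J g D <->
  forall i p, U i p -> isotropic g p (Omega i p).
Proof.
(* The residue 0 is the index 3. *)
have cover3 (a : 'Z_3) : [\/ a = 1, a = 2 | a = 3].
  case: a => [[|[|[|//]]]] lt3; [apply: Or33|apply: Or31|apply: Or32];
  exact: val_inj.
have sq1 i p : U i p -> sqnorm_nabla J g D 1 p = 0.
  move=> Uip; rewrite (@sqnorm_nabla_pure _ _ _ _ _ _ _ 1 _ 0).
    by rewrite metric0l mulr0.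
  by move=> x y; rewrite (hJ1 i) // Defs.metric_sym metric0l scale0r.
have sq2 i p : U i p ->
    sqnorm_nabla J g D 2 p = - (4 * n)%:R * g p (Omega i p) (Omega i p).
  move=> Uip; rewrite (@sqnorm_nabla_pure _ _ _ _ _ _ _ 3 _ (Omega i p)).
    by rewrite mulN1r.
  by move=> x y; rewrite (hJ2 i) // hOmega.
have sq3 i p : U i p ->
    sqnorm_nabla J g D 3 p = - (4 * n)%:R * g p (Omega i p) (Omega i p).
  move=> Uip; rewrite (@sqnorm_nabla_pure _ _ _ _ _ _ _ 2 _ (- Omega i p)).
    by rewrite metricNN mulN1r.
  by move=> x y; rewrite (hJ3 i) // hOmega // metricNr.
split=> [iso i p Uip|iso a p].
  have [x [y nz]] := hJ2nz p.
  (* In dimension 0 every tangent vector is 0, so nabla J_2 would vanish at p. *)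
  have dim_gt0 : (0 < 4 * n)%N.
    rewrite lt0n; apply/eqP => d0; apply: nz; apply/rowP => k.
    by have := ltn_ord k; rewrite [X in (_ < X)%N]d0.
  split.
    have /eqP := iso 2 p.
    by rewrite (sq2 i) // mulf_eq0 oppr_eq0 pnatr_eq0 -leqn0 leqNgt dim_gt0 /= => /eqP.
  move=> Omega0; apply: nz.
  by rewrite (hJ2 i) // hOmega // Omega0 Defs.metric_sym metric0l scale0r.
have [i Uip] := Ucover p; have [gOO _] := iso i p Uip.
by case: (cover3 a) => ->; rewrite ?(sq1 i) ?(sq2 i) ?(sq3 i) // gOO mulr0.
Qed.
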